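(* The sequence $(E_{n,w}(x))_{n\ge 0}$ of weighted Euler polynomials is the Appell sequence for the invertible series $g(t)=\frac{we^{t}+1}{2}$.
   Context: Let $p$ be a fixed odd prime, $\mathbb{C}_p$ the completion of an algebraic closure of $\mathbb{Q}_p$ with absolute value normalized by $|p|_p=p^{-1}$, and let $w\in\mathbb{C}_p$ satisfy $|1-w|_p<1$. The weighted Euler polynomials $E_{n,w}(x)$ ($n\ge 0$) are defined by the formal power series identity $\frac{2}{we^t+1}e^{xt}=\sum_{n=0}^\infty E_{n,w}(x)\frac{t^n}{n!}$. Umbral calculus conventions: let $\mathcal{F}$ be the algebra of formal power series $f(t)=\sum_{k\ge 0}a_k\frac{t^k}{k!}$ and $\mathcal{P}$ the polynomials in $x$, both with coefficients in $\mathbb{C}_p$. Each $f(t)\in\mathcal{F}$ acts as a linear functional on $\mathcal{P}$ by $\langle f(t)|x^n\rangle=a_n$ for all $n\ge 0$. A series is invertible if its constant term is nonzero, and a delta series if its constant term is zero and its coefficient of $t$ is nonzero. For an invertible series $g(t)$ and a delta series $f(t)$, the Sheffer sequence for $(g(t),f(t))$ is the unique sequence of polynomials $S_n(x)$ with $\deg S_n=n$ such that $\langle g(t)f(t)^k|S_n(x)\rangle=n!\,\delta_{n,k}$ for all $n,k\ge 0$. The Appell sequence for $g(t)$ is the Sheffer sequence for $(g(t),t)$. *)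

(* Defs.v *)
From HB Require Import structures.
From mathcomp Require Import all_boot all_order all_algebra.
From mathcomp Require Import boolp reals.
From mathcomp Require Import zify.

Set Implicit Arguments.
Unset Strict Implicit.
Unset Printing Implicit Defensive.

Import Order.TTheory GRing.Theory Num.Theory.
Local Open Scope ring_scope.

(* R[[t]].  The stored coefficients are the ordinary ones: the series written
   \sum_k a_k t^k / k! has k-th coefficient a_k / k!. *)
Record fps (R : Type) := Fps { fps_coef :> nat -> R }.

Lemma fpsP (R : Type) (f g : fps R) : (forall n, f n = g n) -> f = g.
Proof.
by case: f g => [f] [g] /= fg; congr Fps; apply: funext.
Qed.

HB.instance Definition _ (R : Type) := gen_eqMixin (fps R).
HB.instance Definition _ (R : Type) := gen_choiceMixin (fps R).

Section FpsZmodule.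
Variable R : zmodType.
Implicit Types f g h : fps R.

Definition fps_zero : fps R := Fps (fun=> 0).
Definition fps_opp f : fps R := Fps (fun n => - f n).
Definition fps_add f g : fps R := Fps (fun n => f n + g n).

Fact fps_addA : associative fps_add.
Proof. by move=> f g h; apply: fpsP => n; rewrite /= addrA. Qed.
Fact fps_addC : commutative fps_add.
Proof. by move=> f g; apply: fpsP => n; rewrite /= addrC. Qed.
Fact fps_add0 : left_id fps_zero fps_add.
Proof. by move=> f; apply: fpsP => n; rewrite /= add0r. Qed.
Fact fps_addN : left_inverse fps_zero fps_opp fps_add.
Proof. by move=> f; apply: fpsP => n; rewrite /= addNr. Qed.

HB.instance Definition _ :=
  GRing.isZmodule.Build (fps R) fps_addA fps_addC fps_add0 fps_addN.

Lemma fps_coef0 n : (0 : fps R) n = 0. Proof. by []. Qed.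
Lemma fps_coefD f g n : (f + g) n = f n + g n. Proof. by []. Qed.
Lemma fps_coefN f n : (- f) n = - f n. Proof. by []. Qed.
Lemma fps_coef_sum I (r : seq I) (P : pred I) (F : I -> fps R) n :
  (\sum_(i <- r | P i) F i) n = \sum_(i <- r | P i) F i n.
Proof. exact: (big_morph (fun f : fps R => f n) (id1 := 0) (op1 := +%R)). Qed.

End FpsZmodule.

Section FpsRing.
Variable R : comNzRingType.
Implicit Types f g h : fps R.

Definition fps_one : fps R := Fps (fun n => (n == 0%N)%:R).
Definition fps_mul f g : fps R :=
  Fps (fun n => \sum_(i < n.+1) f i * g (n - i)%N).
Definition fps_scale (a : R) f : fps R := Fps (fun n => a * f n).

Let trunc N f := \poly_(i < N) f i.

Let coef_trunc N f g n : (n < N)%N ->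
  (trunc N f * trunc N g)`_n = fps_mul f g n.
Proof.
move=> nN; rewrite coefM; apply: eq_bigr => i _; rewrite !coef_poly.
by rewrite !(leq_ltn_trans _ nN) ?leq_subr // -ltnS.
Qed.

Fact fps_mulC : commutative fps_mul.
Proof.
by move=> f g; apply: fpsP => n; rewrite -!(@coef_trunc n.+1) // mulrC.
Qed.
Fact fps_mulA : associative fps_mul.
Proof.
move=> f g h; apply: fpsP => n.
have E (f1 f2 f3 : fps R) : fps_mul f1 (fps_mul f2 f3) n =
    (trunc n.+1 f1 * (trunc n.+1 f2 * trunc n.+1 f3))`_n.
  rewrite coefM; apply: eq_bigr => i _.
  by rewrite coef_poly ltn_ord coef_trunc // ltnS leq_subr.
by rewrite E fps_mulC E mulrA mulrC.
Qed.
Fact fps_mul1 : left_id fps_one fps_mul.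
Proof.
move=> f; apply: fpsP => n; rewrite /= big_ord_recl /= subn0 mul1r.
by rewrite big1 ?addr0 // => i _; rewrite mul0r.
Qed.
Fact fps_mulDl : left_distributive fps_mul +%R.
Proof.
move=> f g h; apply: fpsP => n; rewrite fps_coefD /= -big_split.
by apply: eq_bigr => i _; rewrite mulrDl.
Qed.
Fact fps_one_neq0 : fps_one != 0 :> fps R.
Proof.
by apply/eqP => /(congr1 (fun f : fps R => f 0%N)) /eqP; rewrite oner_eq0.
Qed.

HB.instance Definition _ := GRing.Zmodule_isComNzRing.Build (fps R)
  fps_mulA fps_mulC fps_mul1 fps_mulDl fps_one_neq0.

Fact fps_scaleA a b f : fps_scale a (fps_scale b f) = fps_scale (a * b) f.
Proof. by apply: fpsP => n; rewrite /= mulrA. Qed.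
Fact fps_scale1 : left_id 1 fps_scale.
Proof. by move=> f; apply: fpsP => n; rewrite /= mul1r. Qed.
Fact fps_scaleDr : right_distributive fps_scale +%R.
Proof. by move=> a f g; apply: fpsP => n; rewrite /= mulrDr. Qed.
Fact fps_scaleDl f : {morph fps_scale^~ f : a b / a + b}.
Proof. by move=> a b; apply: fpsP => n; rewrite /= mulrDl. Qed.

HB.instance Definition _ := GRing.Zmodule_isLmodule.Build R (fps R)
  fps_scaleA fps_scale1 fps_scaleDr fps_scaleDl.

Fact fps_scaleAl (a : R) f g : a *: (f * g) = (a *: f) * g.
Proof.
apply: fpsP => n; rewrite /= mulr_sumr.
by apply: eq_bigr => i _; rewrite mulrA.
Qed.

HB.instance Definition _ :=
  GRing.Lmodule_isLalgebra.Build R (fps R) fps_scaleAl.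
HB.instance Definition _ := GRing.Lalgebra_isComAlgebra.Build R (fps R).

Lemma fps_coef1 n : (1 : fps R) n = (n == 0%N)%:R. Proof. by []. Qed.
Lemma fps_coefM f g n : (f * g) n = \sum_(i < n.+1) f i * g (n - i)%N.
Proof. by []. Qed.
Lemma fps_coefZ a f n : (a *: f) n = a * f n. Proof. by []. Qed.
Lemma fps_coefM0 f g : (f * g) 0%N = f 0%N * g 0%N.
Proof. by rewrite fps_coefM big_ord1. Qed.

Lemma fps_coefX_small f k n : f 0%N = 0 -> (n < k)%N -> (f ^+ k) n = 0.
Proof.
move=> f0; elim: k n => [//|k IHk] n nk; rewrite exprS fps_coefM.
apply: big1 => -[[|i] /= lin] _; first by rewrite f0 mul0r.
by rewrite IHk ?mulr0 //; lia.
Qed.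

End FpsRing.

Section FpsUnitRing.
Variable R : comUnitRingType.
Implicit Types f g : fps R.

Definition fps_unit : pred (fps R) := fun f => f 0%N \is a GRing.unit.

(* With a = f 0, the inverse is a^-1 \sum_k (1 - a^-1 f)^k; the terms with
   k > n do not contribute to the coefficient of t^n. *)
Definition fps_inv f : fps R :=
  if fps_unit f then
    Fps (fun n => (f 0%N)^-1 *
                  (\sum_(k < n.+1) (1 - (f 0%N)^-1 *: f) ^+ k) n)
  else f.

Fact fps_mulVf : {in fps_unit, left_inverse 1 fps_inv *%R}.
Proof.
move=> f uf; rewrite /fps_inv; have -> : fps_unit f by [].
set u := 1 - _; have u0 : u 0%N = 0.
  by rewrite /u fps_coefD fps_coefN fps_coefZ mulVr // subrr.
have fE : f = f 0%N *: (1 - u).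
  by rewrite opprB addrCA subrr addr0 scalerA mulrV // scale1r.
apply: fpsP => n.
transitivity (((f 0%N)^-1 *: (\sum_(k < n.+1) u ^+ k) * f) n).
  rewrite !fps_coefM; apply: eq_bigr => -[i /= lin] _; congr (_ * _ * _).
  rewrite !fps_coef_sum -!(big_mkord xpredT (fun k => (u ^+ k) i)).
  rewrite [RHS](@big_cat_nat _ _ _ i.+1) //= [X in _ = _ + X]big_nat_cond.
  rewrite [X in _ = _ + X]big1 ?addr0 // => k /andP[/andP[ik _] _].
  by rewrite fps_coefX_small.
rewrite [X in _ * X]fE -scalerAl -scalerAr scalerA mulVr // scale1r mulrC.
have -> : (1 - u) * (\sum_(k < n.+1) u ^+ k) = 1 - u ^+ n.+1.
  by rewrite -opprB mulNr -subrX1 opprB.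
by rewrite fps_coefD fps_coefN fps_coefX_small // subr0.
Qed.
Fact fps_unitP f g : g * f = 1 -> fps_unit f.
Proof.
move=> /(congr1 (fun h : fps R => h 0%N)); rewrite fps_coefM0 => gf1.
by apply/unitrPr; exists (g 0%N); rewrite mulrC.
Qed.
Fact fps_inv_out : {in [predC fps_unit], fps_inv =1 id}.
Proof. by move=> f; rewrite inE /fps_inv => /negbTE; rewrite /in_mem /= => ->. Qed.

HB.instance Definition _ := GRing.ComNzRing_hasMulInverse.Build (fps R)
  fps_mulVf fps_unitP fps_inv_out.

(* e^(c t) *)
Definition fps_exp (c : R) : fps R := Fps (fun n => c ^+ n / n`!%:R).

End FpsUnitRing.

Definition fps_t (R : comNzRingType) : fps R := Fps (fun n => (n == 1%N)%:R).

Section Umbral.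
Variable K : fieldType.
Implicit Types (f g : fps K) (q : {poly K}) (S : nat -> {poly K}).

(* < f | x^i > = i! f_i, extended linearly *)
Definition umbral f q : K := \sum_(i < size q) q`_i * (i`!%:R * f i).

Definition invertible_series f : Prop := f 0%N <> 0.
Definition delta_series f : Prop := f 0%N = 0 /\ f 1%N <> 0.

Definition sheffer_conditions g f S : Prop :=
  (forall n, size (S n) = n.+1) /\
  (forall n k, umbral (g * f ^+ k) (S n) = n`!%:R * (n == k)%:R).

Definition is_sheffer g f S : Prop :=
  [/\ invertible_series g, delta_series f & unique (sheffer_conditions g f) S].

Definition is_appell g S : Prop := is_sheffer g (fps_t K) S.

(* n! times the coefficient of t^n in 2 / (w e^t + 1) * e^(x t), a series with
   coefficients in K[x] *)
Definition weighted_euler (w : K) (n : nat) : {poly K} :=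
  n`!%:R * (2%:R / (w%:P *: fps_exp 1 + 1) * fps_exp 'X : fps {poly K}) n.

Lemma weighted_euler_egf (w : K) : [pchar K] =i pred0 -> 1 + w != 0 ->
  (w%:P *: fps_exp 1 + 1) * Fps (fun n => (n`!%:R)^-1 * weighted_euler w n) =
  2%:R * fps_exp 'X.
Proof.
move=> /pcharf0P K0 w1.
have -> : Fps (fun n => (n`!%:R)^-1 * weighted_euler w n) =
    2%:R / (w%:P *: fps_exp 1 + 1) * fps_exp 'X.
  apply: fpsP => n; rewrite /= /weighted_euler mulKr //.
  by rewrite -polyC_natr poly_unitE size_polyC coefC /= unitfE K0 -lt0n fact_gt0.
rewrite mulrA mulrCA mulrV ?mulr1 //.
change ((w%:P *: fps_exp 1 + 1 : fps {poly K}) 0%N \is a GRing.unit).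
rewrite fps_coefD fps_coefZ fps_coef1 /= expr0 divr1 mulr1 -polyCD.
by rewrite poly_unitE size_polyC coefC /= unitfE addrC w1.
Qed.

End Umbral.

Section PadicComplex.
Variable R : realType.

Record is_absolute_value (F : fieldType) (v : F -> R) : Prop := {
  absv_ge0 : forall x, 0 <= v x;
  absv_eq0 : forall x, v x = 0 <-> x = 0;
  absvM : forall x y, v (x * y) = v x * v y;
  absv_triangle : forall x y, v (x + y) <= v x + v y }.

Definition cauchy_seq_for (F : fieldType) (v : F -> R) (s : nat -> F) : Prop :=
  forall e, 0 < e -> exists N, forall m n,
    (N <= m)%N -> (N <= n)%N -> v (s m - s n) < e.

Definition converges_for (F : fieldType) (v : F -> R) (s : nat -> F) (l : F) :
    Prop :=
  forall e, 0 < e -> exists N, forall n, (N <= n)%N -> v (s n - l) < e.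

Record is_completion (F K : fieldType) (u : F -> R) (v : K -> R)
    (i : F -> K) : Prop := {
  completion_absv : is_absolute_value v;
  completion_isometry : forall x, v (i x) = u x;
  completion_dense : forall y e, 0 < e -> exists x, v (y - i x) < e;
  completion_complete : forall s, cauchy_seq_for v s ->
    exists l, converges_for v s l }.

Definition padic_abs (p : nat) (x : rat) : R :=
  if x == 0 then 0
  else p%:R ^ ((logn p `|denq x|%N)%:Z - (logn p `|numq x|%N)%:Z).

(* Q_p is the completion of Q, Qpbar an algebraic closure of Q_p and C_p the
   completion of Qpbar.  These data are unique up to isometric isomorphism. *)
Record padic_complex (p : nat) := PadicComplex {
  pc_Qp : fieldType;
  pc_absQp : pc_Qp -> R;
  pc_ratQp : {rmorphism rat -> pc_Qp};
  pc_Qp_completion : is_completion (padic_abs p) pc_absQp pc_ratQp;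
  pc_Qpbar : closedFieldType;
  pc_absQpbar : pc_Qpbar -> R;
  pc_QpQpbar : {rmorphism pc_Qp -> pc_Qpbar};
  pc_Qpbar_algebraic : forall x, algebraicOver pc_QpQpbar x;
  pc_Qpbar_absv : is_absolute_value pc_absQpbar;
  pc_Qpbar_extends : forall x, pc_absQpbar (pc_QpQpbar x) = pc_absQp x;
  pc_field :> fieldType;
  pc_abs : pc_field -> R;
  pc_QpbarCp : {rmorphism pc_Qpbar -> pc_field};
  pc_completion : is_completion pc_absQpbar pc_abs pc_QpbarCp }.

End PadicComplex.

(* Main.v *)
(* Writing h = 1/g, the generating function gives
   E_n = \sum_i n! / (n - i)! h_i x^(n-i).  Since < f | x^j > = j! f_j, every
   series f satisfies < f | E_n > = n! [t^n] (h f), and f = g t^k yields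
   n! delta_{n,k}.  The series g is invertible because w = -1 would give
   |1 - w| = |2| = 1, p being odd. *)
Require Import Defs.
From mathcomp Require Import all_boot all_order all_algebra.
From mathcomp Require Import boolp reals.
From mathcomp Require Import ring.

Set Implicit Arguments.
Unset Strict Implicit.
Unset Printing Implicit Defensive.

Import Order.TTheory GRing.Theory Num.Theory.
Local Open Scope ring_scope.

Lemma fps_tX (R : comNzRingType) k n : (fps_t R ^+ k) n = (n == k)%:R.
Proof.
elim: k n => [//|k IHk] [|n]; rewrite exprS fps_coefM.
  by rewrite big_ord1 mul0r.
rewrite big_ord_recl mul0r add0r big_ord_recl /= mul1r subSS subn0 IHk eqSS.
by rewrite big1 ?addr0 // => i _; rewrite mul0r.
Qed.

(** The embedding of R[[t]] into R[x][[t]]: it lets an inverse taken over the field serve in the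
    ring where [weighted_euler] divides. *)
Definition fps_polyC (R : comNzRingType) (f : fps R) : fps {poly R} :=
  Fps (fun n => (f n)%:P).

Lemma fps_polyCM (R : comNzRingType) (f g : fps R) :
  fps_polyC (f * g) = fps_polyC f * fps_polyC g.
Proof.
apply: fpsP => n; rewrite !fps_coefM [LHS]/= rmorph_sum.
by apply: eq_bigr => i _; rewrite rmorphM.
Qed.

Section Appell.
Variable K : fieldType.
Hypothesis K0 : [pchar K] =i pred0.
Implicit Types (f g : fps K) (q : {poly K}).

Let fact_neq0 n : (n`!%:R : K) != 0.
Proof. by have /pcharf0P -> := K0; rewrite -lt0n fact_gt0. Qed.

Lemma umbral_widen f q N : (size q <= N)%N ->
  umbral f q = \sum_(i < N) q`_i * (i`!%:R * f i).
Proof.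
move=> qN; rewrite /umbral (big_ord_widen _ (fun i => q`_i * (i`!%:R * f i)) qN).
rewrite big_mkcond; apply: eq_bigr => i _; case: ltnP => // qi.
by rewrite nth_default ?mul0r.
Qed.

Lemma umbralB f q1 q2 : umbral f (q1 - q2) = umbral f q1 - umbral f q2.
Proof.
set N := maxn (size q1) (size q2).
rewrite !(@umbral_widen _ _ N) ?leq_maxl ?leq_maxr //; last first.
  by rewrite (leq_trans (size_polyD _ _)) // size_polyN.
by rewrite -sumrB; apply: eq_bigr => i _; rewrite coefB mulrBl.
Qed.

(** The factor t^m kills the coefficients below m and the degree of [q] those above, so only the
    term at x^m survives. *)
Lemma umbral_Xt g q m : size q = m.+1 ->
  umbral (g * fps_t K ^+ m) q = lead_coef q * (m`!%:R * g 0%N).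
Proof.
move=> sq; rewrite (@umbral_widen _ _ m.+1) ?sq // big_ord_recr /= big1 ?add0r.
  rewrite lead_coefE sq /=; congr (_ * (_ * _)).
  rewrite big_ord_recl fps_tX subn0 eqxx mulr1 big1 ?addr0 // => i _.
  by rewrite fps_tX ltn_eqF ?mulr0 //= subnSK // leq_subr.
move=> i _; rewrite big1 ?mulr0 // => j _.
by rewrite fps_tX ltn_eqF ?mulr0 // (leq_ltn_trans (leq_subr _ _)).
Qed.

(** Gives uniqueness of Appell sequences: taking [k] to be the degree of a nonzero [q] would force
    its leading coefficient to vanish. *)
Lemma umbral_eq0 g q : g 0%N != 0 ->
  (forall k, umbral (g * fps_t K ^+ k) q = 0) -> q = 0.
Proof.
move=> g0 gq; apply/eqP; apply: contraT => q0.
have /eqP := gq (size q).-1; rewrite umbral_Xt ?prednK ?size_poly_gt0 //.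
by rewrite !mulf_eq0 lead_coef_eq0 (negPf q0) (negPf g0) (negPf (fact_neq0 _)).
Qed.

(** The sequence with exponential generating function h(t) e^(xt). *)
Definition appell (h : fps K) n : {poly K} :=
  n`!%:R * (fps_polyC h * fps_exp 'X) n.

Lemma appellE h n :
  appell h n = \poly_(i < n.+1) (n`!%:R * (h (n - i)%N * (i`!%:R)^-1)).
Proof.
(* With the exponential as first factor, the convolution index is the exponent of x. *)
rewrite /appell mulrC [fps_polyC h * _]mulrC fps_coefM poly_def mulr_suml.
apply: eq_bigr => i _ /=.
rewrite -!polyC_natr polyCV -!mulrA -!polyCM -mul_polyC mulrC.
by congr (_%:P * _); ring.
Qed.

Lemma size_appell (h : fps K) n : h 0%N != 0 -> size (appell h n) = n.+1.
Proof.
move=> h0; rewrite appellE size_poly_eq // subnn.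
by rewrite !mulf_neq0 ?invr_eq0 ?fact_neq0.
Qed.

Lemma umbral_appell f h n : umbral f (appell h n) = n`!%:R * (h * f) n.
Proof.
rewrite appellE (@umbral_widen _ _ n.+1) ?size_poly // mulrC [h * f]mulrC fps_coefM.
rewrite mulr_suml; apply: eq_bigr => i _; rewrite coef_poly ltn_ord.
by field; apply: fact_neq0.
Qed.

Lemma is_appell_appell g h : g * h = 1 -> is_appell g (appell h).
Proof.
move=> gh; have /eqP := congr1 (fun f : fps K => f 0%N) gh.
rewrite fps_coefM0 fps_coef1 /= => gh0.
have [g0 h0] : g 0%N != 0 /\ h 0%N != 0.
  by apply/andP; rewrite -negb_or -mulf_eq0 (eqP gh0) oner_neq0.
have E n k : umbral (g * fps_t K ^+ k) (appell h n) = n`!%:R * (n == k)%:R.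
  by rewrite umbral_appell mulrA [h * g]mulrC gh mul1r fps_tX.
split; first exact/eqP.
  by split=> //; apply/eqP; rewrite oner_neq0.
split; first by split=> // n; rewrite size_appell.
(* Both sequences have the same pairings with every g t^k, so each difference is annihilated by all
   of them. *)
move=> S [_ SE]; apply: funext => n; apply/eqP; rewrite -subr_eq0; apply/eqP.
by apply: (umbral_eq0 g0) => k; rewrite umbralB E SE subrr.
Qed.

(** The quotient 2 / (w e^t + 1), formed over K[x], is the image of [g^-1] from K[[t]]. *)
Lemma weighted_euler_appell (w : K) : 1 + w != 0 ->
  is_appell (2%:R^-1 *: (w *: fps_exp 1 + 1)) (weighted_euler w).
Proof.
move=> w1; set g := _ *: _; have two0 : (2%:R : K) != 0 by exact: (fact_neq0 2).
have ug : g \is a GRing.unit.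
  (* A series is a unit exactly when its constant term is; here that term is (w + 1) / 2. *)
  change (g 0%N \is a GRing.unit); rewrite unitfE /g fps_coefZ fps_coefD.
  by rewrite fps_coefZ /= expr0 divr1 mulr1 addrC mulf_neq0 ?invr_eq0.
suff -> : weighted_euler w = appell g^-1 by apply: is_appell_appell; rewrite divrr.
apply: funext => n; rewrite /weighted_euler /appell; congr (_ * (_ * _ : fps {poly K}) n).
set G := _ + 1; have GE : G = 2%:R * fps_polyC g.
  rewrite mulr_natl -scaler_nat; apply: fpsP => m.
  rewrite fps_coefZ fps_coefD fps_coefZ /= !expr1n !mul1r.
  rewrite -!polyC_natr polyCV -!polyCM -polyCD.
  by rewrite mulrA divff // mul1r.
have Gg : G * fps_polyC g^-1 = 2%:R.
  rewrite GE -mulrA -fps_polyCM divrr //.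
  have -> : fps_polyC (1 : fps K) = 1 by apply: fpsP => m; rewrite /= polyC_natr.
  by rewrite mulr1.
have uG : G \is a GRing.unit.
  change (G 0%N \is a GRing.unit); rewrite fps_coefD fps_coefZ /= expr0 divr1 mulr1.
  by rewrite -polyCD poly_unitE size_polyC coefC /= unitfE addrC w1.
by rewrite -Gg mulrC mulKr.
Qed.

End Appell.

(** Each of the embeddings from Q through Q_p and its algebraic closure to C_p preserves absolute
    values. *)
Lemma padic_complex_rat (R : realType) p (Cp : padic_complex R p) :
  exists i : {rmorphism rat -> Cp}, forall x, pc_abs (i x) = padic_abs R p x.
Proof.
exists (@pc_QpbarCp R p Cp \o @pc_QpQpbar R p Cp \o @pc_ratQp R p Cp) => x /=.
rewrite (completion_isometry (pc_completion Cp)) pc_Qpbar_extends.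
by rewrite (completion_isometry (pc_Qp_completion Cp)).
Qed.

Lemma padic_abs2 (R : realType) p : odd p -> padic_abs R p 2%:R = 1.
Proof.
move=> p_odd; rewrite /padic_abs pnatr_eq0.
have -> : numq 2%:R = 2%:Z by exact: (numq_int 2).
have -> : denq 2%:R = 1 by exact: (denq_int 2).
(* [logn p 2] is nonzero only for a prime [p] dividing 2, that is for p = 2, which is even. *)
rewrite logn1 lognE /=; case: ifP => [/andP[pp]|_]; last by rewrite subrr expr0z.
by rewrite dvdn_prime2 // => /eqP p2; rewrite p2 in p_odd.
Qed.

Theorem theorem2p1 (R : realType) (p : nat) (p_prime : prime p) (p_odd : odd p)
    (Cp : padic_complex R p) (w : Cp) (hw : pc_abs (1 - w) < 1) :
  is_appell (2%:R^-1 *: (w *: fps_exp 1 + 1) : fps Cp) (weighted_euler w).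
Proof.
have [i iE] := padic_complex_rat Cp.
apply: weighted_euler_appell.
  (* Characteristic zero is inherited from Q through the injective [i]. *)
  by apply/pcharf0P => n; rewrite -(rmorph_nat i) fmorph_eq0 pnatr_eq0.
apply/negP; rewrite addrC addr_eq0 => /eqP wN1; move: hw.
by rewrite wN1 opprK -[1 + 1]/(2%:R) -(rmorph_nat i) iE padic_abs2 // ltxx.
Qed.
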